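(* Let $E$ be a Banach space and let $F, G$ be closed subspaces of $E$ with $E = F \oplus G$. If both $F$ and $G$ have the SHAI property, then $E$ has the SHAI property.
   Context: All Banach spaces are over $\mathbb{C}$. For a Banach space $X$, $\mathcal{B}(X)$ denotes the algebra of bounded linear operators on $X$. A Banach space $X$ has the SHAI property (Surjective Homomorphisms Are Injective) if for every non-zero Banach space $Y$, every surjective algebra homomorphism $\psi: \mathcal{B}(X) \rightarrow \mathcal{B}(Y)$ (a linear multiplicative map; continuity is not assumed) is injective. *)

(* Defs.v *)
From HB Require Import structures.
From mathcomp Require Import all_boot all_order all_algebra.
From mathcomp Require Import boolp classical_sets functions reals topology.
From mathcomp Require Import normedtype.

Set Implicit Arguments.
Unset Strict Implicit.
Unset Printing Implicit Defensive.

Import Order.TTheory GRing.Theory Num.Theory.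
Import numFieldNormedType.Exports.

Local Open Scope classical_set_scope.
Local Open Scope ring_scope.

(* Norms take their values in K; over K = R[i], where 0 <= z means that z is
   real and non-negative, this is the usual notion. *)

Section BoundedOperators.
Variables (K : numFieldType) (X : normedModType K).

Definition bounded_linear (f : X -> X) : Prop :=
  linear f /\ exists M : K, forall x, `|f x| <= M * `|x|.

Definition bounded_linear_pred : {pred X -> X} :=
  fun f => `[< bounded_linear f >].

Record boundedOp := BoundedOp {
  boundedOp_fun :> X -> X;
  boundedOpP : boundedOp_fun \in bounded_linear_pred }.

HB.instance Definition _ := [isSub for boundedOp_fun].
HB.instance Definition _ := [Choice of boundedOp by <:].

Lemma bounded_linearP (f : boundedOp) : bounded_linear f.
Proof. exact/asboolP/boundedOpP. Qed.

(* The constant M can always be taken non-negative. *)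
Lemma bounded_linear_ge0 (f : X -> X) : bounded_linear f ->
  exists2 M : K, 0 <= M & forall x, `|f x| <= M * `|x|.
Proof.
move=> [_ [M fM]]; exists `|M| => // x.
rewrite -[X in _ * X]normr_id -normrM ger0_norm ?fM//.
exact: le_trans (fM x).
Qed.

Lemma bounded_linear_submod_closed : submod_closed bounded_linear_pred.
Proof.
split=> [|a f g]; rewrite ?unfold_in.
  apply/asboolP; split=> [b x y|]; first by rewrite scaler0 addr0.
  by exists 0 => x; rewrite normr0 mul0r.
move=> /asboolP Hf /asboolP Hg; apply/asboolP.
have [[lf _] [lg _]] := (Hf, Hg).
have [M M0 fM] := bounded_linear_ge0 Hf.
have [N N0 gN] := bounded_linear_ge0 Hg.
split=> [b x y|].
  rewrite !fctE/= lf lg !scalerDr !scalerA [a * b]mulrC.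
  by rewrite -!addrA; congr (_ + _); rewrite addrCA.
exists (`|a| * M + N) => x; rewrite !fctE/= (le_trans (ler_normD _ _))//.
by rewrite normrZ mulrDl -mulrA lerD// ler_wpM2l.
Qed.

HB.instance Definition _ :=
  GRing.SubChoice_isSubLmodule.Build K (X -> X) bounded_linear_pred boundedOp
    bounded_linear_submod_closed.

Lemma bounded_linear_id : id \in bounded_linear_pred.
Proof. by apply/asboolP; split=> //; exists 1 => x; rewrite mul1r. Qed.

Lemma bounded_linear_comp (f g : boundedOp) : f \o g \in bounded_linear_pred.
Proof.
have [[lf _] [lg _]] := (bounded_linearP f, bounded_linearP g).
have [M M0 fM] := bounded_linear_ge0 (bounded_linearP f).
have [N N0 gN] := bounded_linear_ge0 (bounded_linearP g).
apply/asboolP; split=> [b x y|]; first by rewrite /= lg lf.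
by exists (M * N) => x; rewrite (le_trans (fM _))// -mulrA ler_wpM2l.
Qed.

Definition idOp : boundedOp := BoundedOp bounded_linear_id.
Definition compOp (f g : boundedOp) : boundedOp :=
  BoundedOp (bounded_linear_comp f g).

Lemma boundedOp_eqP (f g : boundedOp) : (f = g) <-> (forall x, f x = g x).
Proof. by split=> [->//|fg]; apply/val_inj/funext. Qed.

Lemma compOpA : associative compOp.
Proof. by move=> f g h; apply/boundedOp_eqP. Qed.

Lemma comp1Op : left_id idOp compOp.
Proof. by move=> f; apply/boundedOp_eqP. Qed.

Lemma compOp1 : right_id idOp compOp.
Proof. by move=> f; apply/boundedOp_eqP. Qed.

Lemma boundedOpDE (f g : boundedOp) x : (f + g) x = f x + g x.
Proof. by []. Qed.

Lemma boundedOpZE a (f : boundedOp) x : (a *: f) x = a *: f x.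
Proof. by []. Qed.

Lemma boundedOpD (f : boundedOp) x y : f (x + y) = f x + f y.
Proof.
by have [lf _] := bounded_linearP f; rewrite -[x]scale1r lf !scale1r.
Qed.

Lemma compOpDl : left_distributive compOp +%R.
Proof. by move=> f g h; apply/boundedOp_eqP. Qed.

Lemma compOpDr : right_distributive compOp +%R.
Proof. by move=> f g h; apply/boundedOp_eqP => x; exact: boundedOpD. Qed.

(* Only a pzRingType: B(X) is the zero ring when X is the zero space. *)
HB.instance Definition _ := GRing.Zmodule_isPzRing.Build boundedOp
  compOpA comp1Op compOp1 compOpDl compOpDr.

Lemma boundedOpME (f g : boundedOp) x : (f * g) x = f (g x).
Proof. by []. Qed.

End BoundedOperators.

Notation "''B' ( X )" := (boundedOp X) (at level 8, format "''B' ( X )").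

(* MathComp's algType requires 1 != 0, so an algebra homomorphism B(X) -> B(Y)
   is given as a linear map that is multiplicative; it need not be unital. *)
Definition SHAI (K : numFieldType) (X : completeNormedModType K) : Prop :=
  forall Y : completeNormedModType K, (exists y : Y, y != 0) ->
  forall psi : 'B(X) -> 'B(Y),
    linear psi ->
    {morph psi : S T / S * T} ->
    (forall T, exists S, psi S = T) ->
    injective psi.

Section ClosedSubspaces.
Variables (K : numFieldType) (E : completeNormedModType K).

Record closedSubspace := ClosedSubspace {
  csub_set :> set E;
  csub0 : csub_set 0;
  csubP : forall (a : K) x y, csub_set x -> csub_set y -> csub_set (a *: x + y);
  csub_closed : closed csub_set }.

Section SubspaceType.
Variable F : closedSubspace.

Definition csub_pred : {pred E} := fun x => `[< csub_set F x >].

Record csubType := CSub { csub_val :> E; csub_valP : csub_val \in csub_pred }.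

HB.instance Definition _ := [isSub for csub_val].
HB.instance Definition _ := [Choice of csubType by <:].

Lemma csub_submod_closed : submod_closed csub_pred.
Proof.
split=> [|a x y]; first exact/asboolP/csub0.
by move=> /asboolP Fx /asboolP Fy; exact/asboolP/csubP.
Qed.

HB.instance Definition _ :=
  GRing.SubChoice_isSubLmodule.Build K E csub_pred csubType csub_submod_closed.

Definition csub_norm (x : csubType) : K := `|csub_val x|.

Lemma csub_normD x y : csub_norm (x + y) <= csub_norm x + csub_norm y.
Proof. exact: ler_normD. Qed.

Lemma csub_normZ a x : csub_norm (a *: x) = `|a| * csub_norm x.
Proof. exact: normrZ. Qed.

Lemma csub_norm0 x : csub_norm x = 0 -> x = 0.
Proof. by move=> /normr0_eq0 x0; exact: val_inj. Qed.

HB.instance Definition _ :=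
  Lmodule_isNormed.Build K csubType csub_normD csub_normZ csub_norm0.

Lemma csub_normE (x : csubType) : `|x| = `|csub_val x|.
Proof. by []. Qed.

Lemma csub_complete (G : set_system csubType) :
  ProperFilter G -> cauchy G -> cvg G.
Proof.
move=> GG /cauchy_ballP Gc.
have vGc : cauchy (csub_val @ G).
  apply/cauchy_ballP => e e0.
  have [[A B] /= [GA GB] AB] := Gc e e0.
  exists (csub_val @` A, csub_val @` B) => /=.
    by split; [apply: filterS GA|apply: filterS GB] => x ?; exists x.
  move=> [_ _] /= [[x Ax <-] [y By <-]].
  by have := AB (x, y) (conj Ax By); rewrite -!ball_normE.
have /cvg_ex[l vGl] : cvg (csub_val @ G) by exact: cauchy_cvg.
have Fl : l \in csub_pred.
  apply/asboolP; apply: (closed_cvg (csub_set F) (@csub_closed F) _ l vGl).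
  by apply: nearW => x; exact/asboolP/csub_valP.
apply/cvg_ex; exists (CSub Fl); apply/cvgrPdist_lt => e e0.
by move/cvgrPdist_lt : vGl => /(_ _ e0).
Qed.

HB.instance Definition _ := Uniform_isComplete.Build csubType csub_complete.

End SubspaceType.

(* Algebraic internal direct sum; for closed F and G in a Banach space it is
   automatically topological, by the open mapping theorem. *)
Definition is_direct_sum (F G : set E) : Prop :=
  (forall x, exists y z, [/\ F y, G z & x = y + z]) /\ F `&` G = [set 0].

End ClosedSubspaces.

(* F as a Banach space in its own right, for the norm of E. *)
Definition csub_banach (K : numFieldType) (E : completeNormedModType K)
  (F : closedSubspace E) : completeNormedModType K := csubType F.

(* Main.v *)
Require Import Defs.
From HB Require Import structures.
From mathcomp Require Import all_boot all_order all_algebra complex.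
From mathcomp Require Import boolp classical_sets functions reals topology.
From mathcomp Require Import normedtype sequences.

(** Let [psi : 'B(E) -> 'B(Y)] be a surjective homomorphism with [Y] non-zero,
    and suppose that it kills some [D != 0]. If [D x0 != 0], the Hahn-Banach
    theorem gives a bounded functional [f] with [f (D x0) != 0]; sandwiching [D]
    between rank-one operators built from [f] and [x0] then produces every
    rank-one operator, so the ideal [ker psi] contains all of them
    ([kernel_rank_one]).

    Let [P] be the projection onto [F] along [G]; it is bounded by the closed
    graph theorem ([direct_sum_projection]). Compression identifies the corner
    [P * 'B(E) * P] with ['B(F)], and likewise the corner of ['B(Y)] at the
    idempotent [psi P] with the bounded operators on the range of [psi P], a
    Banach space. Hence [psi] induces a surjective homomorphism from ['B(F)]
    onto the operators on that range. If [psi P != 0] the range is non-zero and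
    the SHAI property of [F] makes [psi] injective on the corner
    ([SHAI_corner]). But [psi P != 0] also forces [P != 0], so the corner
    contains a non-zero rank-one operator, which [psi] kills. Therefore
    [psi P = 0] ([kernel_projection]), and [psi (1 - P) = 0] by the same
    argument for [G]. Then [1 = psi 1 = psi P + psi (1 - P) = 0] in ['B(Y)],
    contradicting [Y != 0].

    The two analytic ingredients are real: the closed graph theorem is deduced
    from Baire's theorem and Hahn-Banach from Zorn's lemma, both over a
    [realType]. They are carried to complex spaces by restricting the scalars
    ([realified]). *)

Set Implicit Arguments.
Unset Strict Implicit.
Unset Printing Implicit Defensive.

Import Order.TTheory GRing.Theory Num.Theory.
Import numFieldNormedType.Exports.

Local Open Scope classical_set_scope.
Local Open Scope ring_scope.
Local Open Scope complex_scope.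

(** * Restriction of scalars from the complex to the real numbers *)

Lemma normc_real (R : rcfType) (a : R) : `|a%:C| = `|a|%:C :> R[i].
Proof. by rewrite normc_def /= expr0n /= addr0 sqrtr_sqr. Qed.

Section Realification.
Variables (R : realType) (X : normedModType R[i]).

(** An alias of [X] without its topology and its complex module structure, so
    that the real structures declared below are the ones inferred for it. *)
Definition realified : Type := X.

HB.instance Definition _ := GRing.Zmodule.on realified.

Definition real_scale (a : R) (x : realified) : realified := a%:C *: (x : X).

Fact real_scaleA a b x : real_scale a (real_scale b x) = real_scale (a * b) x.
Proof. by rewrite /real_scale scalerA rmorphM. Qed.

Fact real_scale1 : left_id 1 real_scale.
Proof. by move=> x; rewrite /real_scale rmorph1 scale1r. Qed.

Fact real_scaleDr : right_distributive real_scale +%R.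
Proof. by move=> a x y; rewrite /real_scale scalerDr. Qed.

Fact real_scaleDl x : {morph real_scale^~ x : a b / a + b}.
Proof. by move=> a b; rewrite /real_scale rmorphD scalerDl. Qed.

HB.instance Definition _ := GRing.Zmodule_isLmodule.Build R realified
  real_scaleA real_scale1 real_scaleDr real_scaleDl.

Lemma realified_scaleE a (x : realified) : a *: x = a%:C *: (x : X) :> X.
Proof. by []. Qed.

(** A complex norm takes its values in [R[i]], on the non-negative real axis:
    the real part loses nothing ([real_normE]). *)
Definition real_norm (x : realified) : R := complex.Re `|(x : X)|.

Lemma real_normE (x : realified) : (real_norm x)%:C = `|(x : X)|.
Proof. by rewrite /real_norm RRe_real// normr_real. Qed.

Fact real_normD x y : real_norm (x + y) <= real_norm x + real_norm y.
Proof. by rewrite -lecR rmorphD /= !real_normE ler_normD. Qed.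

Fact real_normZ a x : real_norm (a *: x) = `|a| * real_norm x.
Proof.
apply: complexI.
by rewrite rmorphM /= !real_normE realified_scaleE normrZ normc_real.
Qed.

Fact real_norm0 x : real_norm x = 0 -> x = 0.
Proof. by move=> x0; apply: normr0_eq0 => /=; rewrite -real_normE x0. Qed.

HB.instance Definition _ :=
  Lmodule_isNormed.Build R realified real_normD real_normZ real_norm0.

Lemma realified_normE (x : realified) : `|x|%:C = `|(x : X)|.
Proof. exact: real_normE. Qed.

(** The positive radii in [R[i]] are exactly the [e%:C] with [0 < e], so the
    balls of the two structures are the same sets. *)
Lemma realified_nbhsE (x : realified) : nbhs x = nbhs (x : X).
Proof.
apply/seteqP; split=> A.
  move=> /nbhs_normP[e /= e0 xeA]; apply/(@nbhs_normP _ X x A).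
  exists e%:C => /=; first by rewrite ltcR.
  move=> y /= xy; apply: xeA => /=.
  by rewrite -ltcR realified_normE.
move=> /(@nbhs_normP _ X x A)[e /= e0 xeA]; apply/(@nbhs_normP _ realified x A).
exists (complex.Re e) => /=; first by move: e0; rewrite ltcE => /andP[].
move=> y /= xy; apply: xeA => /=.
have := xy; rewrite -ltcR realified_normE RRe_real//.
exact/ger0_real/ltW.
Qed.

End Realification.

Lemma realified_complete (R : realType) (X : completeNormedModType R[i])
  (A : set_system (realified X)) : ProperFilter A -> cauchy A -> cvg A.
Proof.
move=> AA /cauchy_ballP Ac.
have /cvg_ex[l Al] : cvg (A : set_system X).
  apply: cauchy_cvg; apply/cauchy_ballP => e e0.
  have e0' : 0 < complex.Re e by move: e0; rewrite ltcE => /andP[].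
  apply: filterS (Ac _ e0') => -[x y].
  rewrite -!ball_normE /= -ltcR realified_normE RRe_real//.
  exact/ger0_real/ltW.
by apply/cvg_ex; exists l => /=; rewrite realified_nbhsE.
Qed.

HB.instance Definition _ (R : realType) (X : completeNormedModType R[i]) :=
  Uniform_isComplete.Build (realified X) (@realified_complete R X).

(** * The closed graph theorem *)

Section ClosedGraph.
Variables (R : realType) (X Y : completeNormedModType R) (T : {linear X -> Y}).

(** Baire: the sublevel sets of [`|T x|] cover the complete space [X], hence
    their closures cannot all have empty interior. *)
Lemma sublevel_closure_ball : exists (n : nat) (x0 : X), exists2 r : R, 0 < r &
  ball x0 r `<=` closure [set x | `|T x| <= n%:R].
Proof.
pose O n := ~` closure [set x | `|T x| <= n%:R].
have Oop n : open (O n) by exact/closed_openC/closed_closure.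
have [i nd] : exists i, ~ dense (O i).
  apply: contrapT => /forallNP dO.
  have dOinf : dense (\bigcap_i O i).
    by apply: Baire => i; split=> //; exact: contrapT (dO i).
  have [||x [_ Ox]] := dOinf setT; [by exists 0|exact: openT|].
  apply: (Ox (Num.truncn `|T x|).+1 I); apply: subset_closure => /=.
  exact/ltW/truncnS_gt.
move/denseNE : nd => [U [[x /open_nbhs_nbhs /nbhs_ballP[r /= r0 xrU]] UO]].
exists i, x; exists r => // y xy; apply: contrapT => Oy.
suff : (U `&` O i) y by rewrite UO => -[].
by split=> //; exact: xrU.
Qed.

(** Differences of points of the ball of [sublevel_closure_ball] fill a ball
    around the origin, where they are limits of differences of points of the
    sublevel set; homogeneity spreads this to all of [X]. *)
Lemma norm_controlled_approximation : exists2 C : R, 0 <= C &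
  forall x e, 0 < e -> exists a, `|x - a| < e /\ `|T a| <= C * `|x|.
Proof.
have [n [x0 [r r0 Bn]]] := sublevel_closure_ball.
have approx y e : `|y| < r -> 0 < e ->
    exists a, `|y - a| < e /\ `|T a| <= (n + n)%:R.
  move=> yr e0; have e20 : 0 < e / 2 by rewrite divr_gt0.
  have near_ z : ball x0 r z -> exists a, `|T a| <= n%:R /\ `|z - a| < e / 2.
    move=> /Bn /(_ _ (nbhsx_ballx z _ e20))[a []] /= Ta.
    by rewrite -ball_normE; exists a.
  have [|a [Ta ya]] := near_ (x0 + y).
    by rewrite -ball_normE /= opprD addNKr normrN.
  have [|b [Tb xb]] := near_ x0; first exact: ballxx.
  exists (a - b); split.
    have -> : y - (a - b) = (x0 + y - a) - (x0 - b).
      rewrite [x0 + y]addrC (addrAC y) [- (x0 - b)]opprB addrACA subrr addr0.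
      by rewrite opprB addrAC addrA.
    by rewrite (le_lt_trans (ler_normB _ _))// [e]splitr ltrD.
  by rewrite linearB natrD (le_trans (ler_normB _ _))// lerD.
exists ((n + n)%:R * 2 / r).
  by apply: divr_ge0; [exact: mulr_ge0|exact: ltW].
move=> x e e0; have [->|x0'] := eqVneq x 0.
  by exists 0; rewrite subrr linear0 !normr0 mulr0.
(* [t] brings [x] to norm [r / 2], well inside the ball of radius [r]. *)
pose t := r / (2 * `|x|).
have t0 : 0 < t by rewrite divr_gt0// mulr_gt0// normr_gt0.
have tx : t * `|x| = r / 2 by rewrite /t invfM -!mulrA mulVf ?mulr1// normr_eq0.
have [||a [xa Ta]] := approx (t *: x) (t * e).
- by rewrite normrZ gtr0_norm// tx ltr_pdivrMr// ltr_pMr// ltr1n.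
- exact: mulr_gt0.
exists (t^-1 *: a); split.
  rewrite -[x]scale1r -(mulVf (lt0r_neq0 t0)) -scalerA -scalerBr normrZ.
  by rewrite gtr0_norm ?invr_gt0// -ltr_pdivlMl ?invr_gt0// invrK.
rewrite linearZ normrZ gtr0_norm ?invr_gt0// ler_pdivrMl//.
by rewrite mulrCA tx mulrA divfK ?lt0r_neq0// mulfK ?pnatr_eq0.
Qed.

Hypothesis graph_closed : forall (u : nat -> X) x y,
  u @ \oo --> x -> (fun n => T (u n)) @ \oo --> y -> T x = y.

(** Approximating [x], then the remainder, and so on, writes [x] as a series
    whose terms have images bounded by a geometric series. The series of images
    converges because [Y] is complete, and its sum is [T x] because the graph of
    [T] is closed. *)
Theorem closed_graph : exists M, forall x, `|T x| <= M * `|x|.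
Proof.
have [C C0 approx] := norm_controlled_approximation.
exists (C / (1 - 2^-1)) => x.
have [->|x0] := eqVneq x 0; first by rewrite linear0 !normr0 mulr0.
pose e n := `|x| * 2^-1 ^+ n.
have e0 n : 0 < e n by rewrite mulr_gt0 ?normr_gt0 ?exprn_gt0 ?invr_gt0.
have /choice[s sP] (p : X * nat) : exists a, `|p.1 - a| < e p.2.+1 /\
    `|T a| <= C * `|p.1| by exact: approx.
(* [z n] is the remainder after [n] steps and [a n] the term taken from it; the
   error [e n.+1] allowed at step [n] halves the bound on the remainder. *)
pose fix z n := if n is m.+1 then z m - s (z m, m) else x.
pose a n := s (z n, n).
have ze n : `|z n| <= e n.
  case: n => [|n] /=; first by rewrite /e expr0 mulr1.
  by have [/ltW] := sP (z n, n).
have az : series a = fun n => x - z n.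
  apply/funext; elim=> [|n IH]; first by rewrite /series /= big_nil subrr.
  by rewrite seriesS IH /= opprB addrCA /a.
have half1 : `|2^-1 : R| < 1 by rewrite normfV normr_nat invf_lt1 ?ltr1n.
have e_cvg : e @ \oo --> 0 by exact: cvg_geometric.
have ax : series a @ \oo --> x.
  rewrite az -[X in _ --> X]subr0; apply: cvgB; first exact: cvg_cst.
  apply/norm_cvg0P; apply: (squeeze_cvgr _ (cvg_cst 0) e_cvg).
  by apply: nearW => n; rewrite normr_ge0 ze.
have Tae n : `|T (a n)| <= geometric (C * `|x|) 2^-1 n.
  have [_ /le_trans] := sP (z n, n); apply; rewrite /= -mulrA ler_wpM2l//.
have gc := is_cvg_geometric_series (a := C * `|x|) half1.
have nTa : cvgn [normed series (fun n => T (a n))].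
  apply: (series_le_cvg _ _ Tae gc) => n //.
  by rewrite /geometric /= ?mulr_ge0 ?exprn_ge0 ?invr_ge0.
have TE : (fun n => T (series a n)) = series (fun n => T (a n)).
  by apply/funext => n; rewrite /series /= linear_sum.
have -> : T x = limn (series (fun n => T (a n))).
  by apply: (graph_closed ax); rewrite TE; exact: normed_cvg.
rewrite (le_trans (lim_series_norm nTa))//.
rewrite (le_trans (lim_series_le nTa gc Tae))//.
by rewrite (cvg_lim _ (cvg_geometric_series (a := C * `|x|) half1))// mulrAC.
Qed.

End ClosedGraph.

(** * The bounded projection of a direct sum *)

Section Projections.
Variables (K : numFieldType) (X : completeNormedModType K).

Lemma csubB (F : closedSubspace X) x y :
  csub_set F x -> csub_set F y -> csub_set F (x - y).
Proof. by move=> Fx Fy; rewrite addrC -scaleN1r; exact: csubP. Qed.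

Lemma csubZ (F : closedSubspace X) a x : csub_set F x -> csub_set F (a *: x).
Proof. by move=> Fx; rewrite -[_ *: _]addr0; apply: csubP; last exact: csub0. Qed.

Definition projects_onto (P : 'B(X)) (F : closedSubspace X) :=
  (forall x, csub_set F (P x)) /\ (forall x, csub_set F x -> P x = x).

Lemma projects_onto_idem P F : projects_onto P F -> P * P = P.
Proof. by move=> [FP PF]; apply/boundedOp_eqP => x; exact/PF/FP. Qed.

End Projections.

(** If [u n] tends to [x] and [P (u n)] to [y], then [y] lies in [F] and [x - y]
    in [G] because both are closed; so [y] is the [F]-component of [x]. This is
    the closed graph hypothesis for the algebraic projection. *)
Lemma direct_sum_projection (R : realType) (X : completeNormedModType R[i])
    (F G : closedSubspace X) : is_direct_sum F G ->
  exists P : 'B(X), projects_onto P F /\ projects_onto (1 - P) G.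
Proof.
move=> [FG FG0].
have /choice[P PFG] x : exists y, csub_set F y /\ csub_set G (x - y).
  by have [y [z [Fy Gz ->]]] := FG x; exists y; rewrite addrC addKr.
have uniqP x y : csub_set F y -> csub_set G (x - y) -> P x = y.
  move=> Fy Gxy; have [FP GP] := PFG x; apply/eqP; rewrite -subr_eq0.
  suff : (F `&` G) (P x - y) by rewrite FG0 => /= ->.
  split; first exact: csubB.
  by rewrite -(subrKA x) addrC -[P x - x]opprB; exact: csubB.
have linP : linear P.
  move=> a x y; have [[Fx Gx] [Fy Gy]] := (PFG x, PFG y).
  apply: uniqP; first exact: csubP.
  by rewrite opprD addrACA -scalerBr; exact: csubP.
have linPR : linear (P : realified X -> realified X).
  by move=> a x y; exact: linP.
pose PR : {linear realified X -> realified X} :=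
  HB.pack (P : realified X -> realified X)
    (GRing.isLinear.Build _ _ _ _ _ linPR).
have closedR (H : closedSubspace X) : closed (H : set (realified X)).
  move=> x xH; apply: (@csub_closed _ _ H) => B xB; apply: xH.
  by rewrite realified_nbhsE.
have [|M PM] := @closed_graph R (realified X) (realified X) PR.
  move=> u x y ux Py; have cvgR := @closed_cvg _ (realified X) \oo _ _ _ (closedR _).
  apply: uniqP.
    by apply: cvgR Py; apply: nearW => n; have [] := PFG (u n).
  by apply: cvgR (cvgB ux Py); apply: nearW => n; have [] := PFG (u n).
have bP : P \in @bounded_linear_pred _ X.
  apply/asboolP; split=> //; exists M%:C => x.
  by rewrite -!realified_normE -rmorphM lecR PM.
exists (BoundedOp bP).
have QE x : (1 - BoundedOp bP) x = x - P x by [].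
split; split=> x; first by case: (PFG x).
- by move=> Fx; apply: uniqP => //; rewrite subrr; exact: csub0.
- by rewrite QE; case: (PFG x).
- move=> Gx; rewrite QE (uniqP x 0) ?subr0//; exact: csub0.
Qed.

(** * The Hahn-Banach theorem *)

Section HahnBanach.
Variables (R : realType) (V : lmodType R) (p : V -> R).
Hypothesis pD : forall x y, p (x + y) <= p x + p y.
Hypothesis pZ : forall a x, 0 <= a -> p (a *: x) = a * p x.

(** The graph of a linear functional on a subspace, below [p] there. The relation
    is single-valued because domination gives [r <= p 0 = 0] for every [(0, r)]
    in [A]. *)
Definition dominated_graph (A : set (V * R)) :=
  (forall a x r y s, A (x, r) -> A (y, s) -> A (a *: x + y, a * r + s)) /\
  (forall x r, A (x, r) -> r <= p x).

Let p0 : p 0 = 0.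
Proof. by rewrite -[0 in LHS](scale0r 0) pZ// mul0r. Qed.

Definition extend_graph (A : set (V * R)) v c : set (V * R) :=
  [set z | exists x r t, A (x, r) /\ z = (x + t *: v, r + t * c)].

(** The bounds on [c] say that [(x, r)] may be moved by [(v, c)] or [(- v, - c)];
    the other multiples of [v] follow by homogeneity of [p]. *)
Lemma extend_dominated (A : set (V * R)) v c : dominated_graph A -> A (0, 0) ->
  (forall x r, A (x, r) -> r - p (x - v) <= c <= p (x + v) - r) ->
  dominated_graph (extend_graph A v c).
Proof.
move=> [Alin Ap] A0 cA; split.
  move=> a _ _ _ _ [x [r [t [Ax [-> ->]]]]] [y [s [t' [Ay [-> ->]]]]].
  exists (a *: x + y), (a * r + s), (a * t + t'); split; first exact: Alin.
  congr (_, _); first by rewrite scalerDr scalerDl -scalerA addrACA.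
  by rewrite mulrDr mulrDl -mulrA addrACA.
move=> _ _ [x [r [t [Ax [-> ->]]]]].
have AZ a : A (a *: x, a * r).
  by rewrite -[a *: x]addr0 -[a * r]addr0; exact: Alin.
have [t0|t0|->] := ltgtP t 0; last by rewrite scale0r mul0r !addr0 Ap.
- have s0 : 0 < - t by rewrite oppr_gt0.
  have /cA/andP[+ _] := AZ (- t)^-1.
  rewrite lerBlDr -(ler_pM2l s0) mulrA mulfV ?lt0r_neq0// mul1r mulrDr.
  rewrite -(pZ _ (ltW s0)) scalerBr scalerA mulfV ?lt0r_neq0// scale1r mulNr.
  by rewrite scaleNr opprK addrC -lerBlDr opprK.
- have /cA/andP[_] := AZ t^-1.
  rewrite lerBrDr -(ler_pM2l t0) mulrDr mulrA mulfV ?lt0r_neq0// mul1r.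
  rewrite -(pZ _ (ltW t0)) scalerDr scalerA mulfV ?lt0r_neq0// scale1r.
  by rewrite addrC.
Qed.

(** Every lower bound is below every upper bound: this is subadditivity of [p]
    applied to [x + y = (x - v) + (y + v)]. *)
Lemma extension_value (A : set (V * R)) v : dominated_graph A -> A (0, 0) ->
  exists c, forall x r, A (x, r) -> r - p (x - v) <= c <= p (x + v) - r.
Proof.
move=> [Alin Ap] A0.
pose S := [set z | exists x r, A (x, r) /\ z = r - p (x - v)].
have bound x r y s : A (x, r) -> A (y, s) -> r - p (x - v) <= p (y + v) - s.
  move=> Ax Ay; rewrite lerBlDr addrAC lerBrDr (le_trans (y := p (x + y)))//.
    by rewrite Ap// -[x]scale1r -[r]mul1r; exact: Alin.
  by rewrite [p (y + v) + _]addrC (le_trans _ (pD _ _))// [y + v]addrC subrKA.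
exists (sup S) => x r Ax; apply/andP; split.
  apply: ub_le_sup; last by exists x, r.
  by exists (p (x + v) - r) => _ [y [s [Ay ->]]]; exact: bound.
apply: ge_sup; first by exists (0 - p (0 - v)), 0, 0.
by move=> _ [y [s [Ay ->]]]; exact: bound.
Qed.

Lemma extend_graphS (A : set (V * R)) v c : A `<=` extend_graph A v c.
Proof. by move=> [x r] Ax; exists x, r, 0; rewrite scale0r mul0r !addr0. Qed.

Lemma extend_graphv (A : set (V * R)) v c :
  A (0, 0) -> extend_graph A v c (v, c).
Proof. by move=> A0; exists 0, 0, 1; rewrite scale1r mul1r !add0r. Qed.

Theorem hahn_banach x0 : exists u : V -> R,
  [/\ forall a x y, u (a *: x + y) = a * u x + u y,
      forall x, u x <= p x & u x0 = p x0].
Proof.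
(* The second condition is restricted to non-empty sets because the union of the
   empty chain has to satisfy [P] too. *)
pose P (A : set (V * R)) := dominated_graph A /\ (A !=set0 -> A (x0, p x0)).
have [F FP Ftot|A [[domA Ax0] maxA]] := @Zorn_bigcup _ P.
  have FD B : F B -> dominated_graph B by move=> /FP[].
  split; last first.
    by move=> [z [B FB Bz]]; exists B => //; have [_] := FP _ FB; apply; exists z.
  split; last by move=> x r [B FB]; have [_] := FD _ FB; exact.
  move=> a x r y s [B FB Bx] [C FC Cy].
  have [BC|CB] := Ftot _ _ FB FC.
    by exists C => //; have [Clin _] := FD _ FC; apply: Clin => //; exact: BC.
  by exists B => //; have [Blin _] := FD _ FB; apply: Blin => //; exact: CB.
(* A maximal set is not empty: the line through [(x0, p x0)] would be larger. *)
have [A00|nA0] := pselect (A (0, 0)); last first.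
  have A_0 : A = set0.
    apply/eqP/negP => /negP/set0P A0; apply: nA0.
    have := domA.1 (-1) _ _ _ _ (Ax0 A0) (Ax0 A0).
    by rewrite scaleN1r mulN1r !addNr.
  have dom0 : dominated_graph [set (0, 0)].
    split=> [a x r y s [-> ->] [-> ->]|x r [-> ->]]; last by rewrite p0.
    by rewrite scaler0 mulr0 !addr0.
  have x0ext := @extend_graphv [set (0, 0)] x0 (p x0) erefl.
  exfalso; apply: (maxA (extend_graph [set (0, 0)] x0 (p x0))).
    rewrite A_0; split; first exact: sub0set.
    by move=> /(_ _ x0ext).
  split=> //; apply: extend_dominated => // x r [-> ->].
  rewrite !add0r subr0 lexx andbT -subr_ge0 opprK -p0 -[0 in leLHS](subrr x0).
  exact: pD.
have Atotal v : exists r, A (v, r).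
  apply: contrapT => nAv.
  have [c cA] := extension_value v domA A00.
  apply: (maxA (extend_graph A v c)).
    split; first exact: extend_graphS.
    by move=> /(_ _ (extend_graphv v c A00)) Av; apply: nAv; exists c.
  split; first exact: extend_dominated.
  by move=> _; apply: extend_graphS; apply: Ax0; exists (0, 0).
have [u Au] := choice Atotal.
have Afun x r s : A (x, r) -> A (x, s) -> r <= s.
  move=> Ar As; have := domA.1 (-1) _ _ _ _ As Ar.
  by move=> /domA.2; rewrite scaleN1r mulN1r addNr p0 addrC subr_le0.
have uE x r : A (x, r) -> u x = r.
  move=> Ar; apply: le_anti.
  by rewrite (Afun _ _ _ (Au x) Ar) (Afun _ _ _ Ar (Au x)).
exists u; split=> [a x y|x|].
- exact/uE/domA.1.
- exact/domA.2.
- by apply/uE/Ax0; exists (0, 0).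
Qed.

End HahnBanach.

Definition bounded_functional (K : numFieldType) (X : normedModType K)
    (f : X -> K) :=
  (forall a x y, f (a *: x + y) = a * f x + f y) /\
  exists M, forall x, `|f x| <= M * `|x|.

Lemma bounded_functionalZ (K : numFieldType) (X : normedModType K)
  (f : X -> K) a x : bounded_functional f -> f (a *: x) = a * f x.
Proof.
move=> [lin _]; have f0 : f 0 = 0.
  by have := lin (-1) 0 0; rewrite scaler0 addr0 mulN1r addNr.
by rewrite -[a *: x]addr0 lin f0 addr0.
Qed.

(** A real functional [u] is the real part of the complex functional
    [u x - 'i * u ('i *: x)], which has at most twice its norm. *)
Lemma separating_functional (R : realType) (X : normedModType R[i]) (x0 : X) :
  x0 != 0 ->
  exists f, bounded_functional f /\ f x0 != 0.
Proof.
move=> x0n0.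
have [||u [ulin ule ux0]] := @hahn_banach R (realified X) Num.norm _ _ x0.
- exact: ler_normD.
- by move=> a x a0; rewrite normrZ ger0_norm.
have u0 : u 0 = 0.
  by have := ulin (-1) 0 0; rewrite scaler0 addr0 mulN1r addNr.
have uD x y : u (x + y) = u x + u y.
  by have := ulin 1 x y; rewrite scale1r mul1r.
have uZ a x : u (a *: x) = a * u x by have := ulin a x 0; rewrite u0 !addr0.
have unorm x : `|u x|%:C <= `|x : X|.
  rewrite -realified_normE lecR ler_norml ule andbT.
  by rewrite lerNl -mulN1r -uZ (le_trans (ule _))// normrZ normrN1 mul1r.
pose f (x : X) := (u x +i* - u ('i *: x))%C.
exists f; split; first split.
- move=> [a b] x y; rewrite /f.
  have uC z : u ((a +i* b)%C *: z : X) = a * u z + b * u ('i *: z : X).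
    rewrite -!uZ -uD !realified_scaleE; congr u.
    rewrite -[RHS]/(a%:C *: (z : X) + b%:C *: ('i *: (z : X))).
    have -> : (a +i* b)%C = a%:C + b%:C * 'i by simpc.
    by rewrite scalerDl scalerA.
  have ii z : 'i *: ('i *: z) = - z :> X.
    by rewrite scalerA -expr2 sqr_i scaleN1r.
  have uN z : u (- z) = - u z by rewrite -scaleN1r uZ mulN1r.
  rewrite scalerDr scalerA mulrC -scalerA !uD !uC ii uN.
  by simpc.
- exists 2 => x.
  have normi : `|'i%C| = 1 :> R[i].
    by rewrite normc_def /= expr0n /= add0r expr1n sqrtr1.
  have -> : f x = (u x)%:C - 'i * (u ('i *: x : X))%:C by rewrite /f; simpc.
  rewrite (le_trans (ler_normB _ _))// normrM normi mul1r !normc_real mulrDl mul1r.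
  by rewrite lerD// (le_trans (unorm _))// normrZ normi mul1r.
- rewrite /f eq_complex /= ux0 negb_and; apply/orP; left.
  by rewrite normr_eq0.
Qed.

(** * Corners of the algebra of operators *)

Lemma boundedOp0 (K : numFieldType) (X : normedModType K) (T : 'B(X)) : T 0 = 0.
Proof. by apply: (addrI (T 0)); rewrite -boundedOpD !addr0. Qed.

Lemma boundedOpZ (K : numFieldType) (X : normedModType K) (T : 'B(X)) a x :
  T (a *: x) = a *: T x.
Proof.
have [lin _] := bounded_linearP T.
by rewrite -[a *: x]addr0 lin boundedOp0 addr0.
Qed.

Lemma boundedOpB (K : numFieldType) (X : normedModType K) (T : 'B(X)) x y :
  T (x - y) = T x - T y.
Proof. by apply: (addIr (T y)); rewrite -boundedOpD !subrK. Qed.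

Lemma boundedOp_neq0 (K : numFieldType) (X : normedModType K) (T : 'B(X)) :
  T != 0 -> exists x, T x != 0.
Proof.
move=> T0; apply: contrapT => /forallNP Tx0; move/eqP: T0; apply.
by apply/boundedOp_eqP => x; apply/eqP; move/negP: (Tx0 x); rewrite negbK.
Qed.

(** [compress] and [extend] are mutually inverse between the corner
    [P * 'B(X) * P] and ['B(F)]. *)
Section Compression.
Variables (K : numFieldType) (X : completeNormedModType K).
Variables (P : 'B(X)) (F : closedSubspace X).
Hypothesis PF : projects_onto P F.

Fact onto_subproof x : P x \in csub_pred F.
Proof. by apply/asboolP; have [+ _] := PF. Qed.

Definition onto x : csub_banach F := CSub (onto_subproof x).

Lemma onto_val (x : csub_banach F) : onto (csub_val x) = x.
Proof. by apply/val_inj/PF.2/asboolP/csub_valP. Qed.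

Fact compress_bounded (T : 'B(X)) : (fun x => onto (T (csub_val x)))
  \in @bounded_linear_pred _ (csub_banach F).
Proof.
have [lin [M PM]] := bounded_linearP (P * T).
apply/asboolP; split; last by exists M => x; exact: PM.
by move=> a x y; apply/val_inj; exact: lin.
Qed.

Definition compress T : 'B(csub_banach F) := BoundedOp (compress_bounded T).

Fact extend_bounded (S : 'B(csub_banach F)) :
  (fun x => csub_val (S (onto x))) \in @bounded_linear_pred _ X.
Proof.
have [linP _] := bounded_linearP P.
have [linS _] := bounded_linearP S.
have [M M0 PM] := bounded_linear_ge0 (bounded_linearP P).
have [N N0 SN] := bounded_linear_ge0 (bounded_linearP S).
apply/asboolP; split.
  move=> a x y; rewrite -[RHS]/(csub_val (a *: S (onto x) + S (onto y))) -linS.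
  by congr (csub_val (S _)); apply/val_inj; exact: linP.
exists (N * M) => x; rewrite -mulrA (le_trans (SN (onto x)))// ler_wpM2l//.
exact: PM.
Qed.

Definition extend S : 'B(X) := BoundedOp (extend_bounded S).

Lemma compress_linear : linear compress.
Proof.
move=> a S T; apply/boundedOp_eqP => x; apply/val_inj.
by have [linP _] := bounded_linearP P; exact: linP.
Qed.

Lemma compress_mul S T : compress (S * P * T) = compress S * compress T.
Proof. exact/boundedOp_eqP. Qed.

Lemma extend_linear : linear extend.
Proof. by move=> a S T; apply/boundedOp_eqP. Qed.

Lemma extend0 : extend 0 = 0.
Proof. exact/boundedOp_eqP. Qed.

Lemma extend_mul : {morph extend : S T / S * T}.
Proof. by move=> S T; apply/boundedOp_eqP => x /=; rewrite onto_val. Qed.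

Lemma extendK : cancel extend compress.
Proof. by move=> S; apply/boundedOp_eqP => x /=; rewrite !onto_val. Qed.

Lemma extend_compress T : extend (compress T) = P * T * P.
Proof. exact/boundedOp_eqP. Qed.

Lemma extend_corner S : P * extend S * P = extend S.
Proof. by rewrite -extend_compress extendK. Qed.

Lemma extend_mulP S : extend S * P = extend S.
Proof. by rewrite -{1}extend_corner -mulrA (projects_onto_idem PF) extend_corner. Qed.

End Compression.

(** The range of a bounded idempotent is its set of fixed points; this
    description shows that it is closed. *)
Section FixedSpace.
Variables (K : numFieldType) (X : completeNormedModType K) (p : 'B(X)).

Definition fixed_set : set X := [set x | p x = x].

Fact fixed_set0 : fixed_set 0.
Proof. exact: boundedOp0. Qed.

Fact fixed_setP a x y : fixed_set x -> fixed_set y -> fixed_set (a *: x + y).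
Proof. by rewrite /fixed_set /= boundedOpD boundedOpZ => -> ->. Qed.

Fact fixed_set_closed : closed fixed_set.
Proof.
have [M M0 pM] := bounded_linear_ge0 (bounded_linearP p).
have M1 : 0 < M + 1 by rewrite ltr_wpDl.
move=> x xfix; apply/eqP; rewrite -subr_eq0 -normr_le0; apply/negP => /negP.
rewrite -real_ltNge ?normr_real ?real0// => d0.
(* For a fixed point [y], [p x - x = p (x - y) - (x - y)] has norm at most
   [(M + 1) * `|x - y|], which rules out a [y] too close to [x]. *)
have e0 : 0 < `|p x - x| / (M + 1) by rewrite divr_gt0.
have [y [/= py]] := xfix _ (nbhsx_ballx x _ e0).
rewrite -ball_normE /= ltr_pdivlMr// => /lt_geF/negP; apply.
have -> : p x - x = p (x - y) - (x - y) by rewrite boundedOpB py opprB addrA subrK.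
by rewrite (le_trans (ler_normB _ _))// mulrC mulrDl mul1r lerD.
Qed.

Definition fixed_space : closedSubspace X :=
  ClosedSubspace fixed_set0 fixed_setP fixed_set_closed.

Lemma projects_onto_fixed_space : p * p = p -> projects_onto p fixed_space.
Proof. by move=> /boundedOp_eqP pp; split=> // x; exact: pp. Qed.

End FixedSpace.

Section Homomorphism.
Variables (K : numFieldType) (X Y : completeNormedModType K).
Variable psi : 'B(X) -> 'B(Y).
Hypothesis psi_linear : linear psi.
Hypothesis psi_mul : {morph psi : S T / S * T}.
Hypothesis psi_surj : forall T, exists S, psi S = T.

Lemma psi0 : psi 0 = 0.
Proof. by have := psi_linear (-1) 0 0; rewrite scaler0 addr0 scaleN1r addNr. Qed.

Lemma psiD S T : psi (S + T) = psi S + psi T.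
Proof. by have := psi_linear 1 S T; rewrite !scale1r. Qed.

Lemma psi1 : psi 1 = 1.
Proof. by have [S S1] := psi_surj 1; rewrite -[LHS]mulr1 -S1 -psi_mul mul1r. Qed.

(** Through the identifications of corners, [psi] becomes a surjective
    homomorphism from ['B(F)] onto the operators on the fixed space of [psi P],
    which is a non-zero Banach space; the SHAI property of [F] applies to it. *)
Lemma SHAI_corner (P : 'B(X)) (F : closedSubspace X) :
  projects_onto P F -> SHAI (csub_banach F) -> psi P != 0 ->
  forall T, psi (P * T * P) = 0 -> P * T * P = 0.
Proof.
move=> PF shF psiP T psiT.
set p := psi P in psiP.
have pp : p * p = p by rewrite -psi_mul (projects_onto_idem PF).
pose G := fixed_space p; have pG : projects_onto p G.
  exact: projects_onto_fixed_space.
pose phi (S : 'B(csub_banach F)) : 'B(csub_banach G) :=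
  compress pG (psi (extend PF S)).
have phi_inj : injective phi.
  apply: shF.
  - have [y py] := boundedOp_neq0 psiP; exists (onto pG y).
    by apply: contra_neq py => /(congr1 (@csub_val _ _ _)).
  - by move=> a S S'; rewrite /phi extend_linear psi_linear compress_linear.
  - move=> S S'; rewrite /phi extend_mul psi_mul -compress_mul.
    by rewrite -[_ * p]psi_mul extend_mulP.
  - move=> T'; have [A psiA] := psi_surj (extend pG T').
    exists (compress PF A); rewrite /phi extend_compress !psi_mul psiA.
    by rewrite extend_corner extendK.
have T0 : compress PF T = 0.
  by apply: phi_inj; rewrite /phi extend_compress psiT extend0 psi0.
by rewrite -(extend_compress PF T) T0 extend0.
Qed.

End Homomorphism.

(** * Rank-one operators in the kernel of a homomorphism *)

Section RankOne.
Variables (K : numFieldType) (X : normedModType K).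

Fact rank_one_bounded (e : X) (f : X -> K) : bounded_functional f ->
  (fun x => f x *: e) \in @bounded_linear_pred _ X.
Proof.
move=> [lin [M fM]]; apply/asboolP; split.
  by move=> a x y; rewrite lin scalerDl scalerA.
by exists (M * `|e|) => x; rewrite normrZ mulrAC ler_wpM2r.
Qed.

Definition rank_one (e : X) (f : X -> K) (bf : bounded_functional f) : 'B(X) :=
  BoundedOp (rank_one_bounded e bf).

End RankOne.

Section ComplexHomomorphism.
Variables (R : realType) (X Y : completeNormedModType R[i]).
Variable psi : 'B(X) -> 'B(Y).
Hypothesis psi_linear : linear psi.
Hypothesis psi_mul : {morph psi : S T / S * T}.

(** If [f (D x0) != 0], any [rank_one e g] is, up to this scalar,
    [rank_one e f * D * rank_one x0 g]. *)
Lemma kernel_rank_one (D : 'B(X)) : psi D = 0 -> D != 0 ->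
  forall e f (bf : bounded_functional f), psi (rank_one e bf) = 0.
Proof.
move=> psiD /boundedOp_neq0[x0 Dx0] e g bg.
have [f [bf fDx0]] := separating_functional Dx0.
have -> : rank_one e bg = rank_one ((f (D x0))^-1 *: e) bf * D * rank_one x0 bg.
  apply/boundedOp_eqP => x /=.
  by rewrite boundedOpZ (bounded_functionalZ _ _ bf) scalerA mulfK.
by rewrite !psi_mul psiD mulr0 mul0r.
Qed.

Hypothesis psi_surj : forall T, exists S, psi S = T.

(** A non-zero corner contains a non-zero rank-one operator, so [psi] cannot both
    kill these and be injective on the corner, as [SHAI_corner] would have it if
    [psi P] were non-zero. *)
Lemma kernel_projection (P : 'B(X)) (F : closedSubspace X) :
  projects_onto P F -> SHAI (csub_banach F) ->
  (forall e f (bf : bounded_functional f), psi (rank_one e bf) = 0) ->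
  psi P = 0.
Proof.
move=> PF shF killed; apply: contrapT => /eqP psiP.
have /boundedOp_neq0[x Px0] : P != 0.
  by apply: contra_neq psiP => ->; exact: psi0.
have [f [bf fPx]] := separating_functional Px0.
(* At [x] this element of the corner takes the value [f (P x) *: P x]. *)
have /boundedOp_eqP/(_ x) : P * rank_one (P x) bf * P = 0.
  apply: (SHAI_corner psi_linear psi_mul psi_surj PF shF psiP).
  by rewrite !psi_mul killed mulr0 mul0r.
rewrite !boundedOpME /= PF.2; last exact/csubZ/PF.1.
by move/eqP; rewrite scaler_eq0 (negPf fPx) (negPf Px0).
Qed.

End ComplexHomomorphism.

(** * The SHAI property of a direct sum *)

Theorem proposition1p6 (R : realType) (E : completeNormedModType R[i])
    (F G : closedSubspace E) :
  is_direct_sum F G ->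
  SHAI (csub_banach F) -> SHAI (csub_banach G) -> SHAI E.
Proof.
move=> FG shF shG Y [y y0] psi psi_linear psi_mul psi_surj S T psiST.
apply: contrapT => /eqP ST.
have killed : forall e f (bf : bounded_functional f), psi (rank_one e bf) = 0.
  apply: (kernel_rank_one psi_mul (D := (-1) *: T + S)).
    by rewrite psi_linear psiST scaleN1r addNr.
  by rewrite scaleN1r addrC subr_eq0.
have [P [PF PG]] := direct_sum_projection FG.
have psiP := kernel_projection psi_linear psi_mul psi_surj PF shF killed.
have psiQ := kernel_projection psi_linear psi_mul psi_surj PG shG killed.
have : (1 : 'B(Y)) = 0.
  rewrite -(psi1 psi_mul psi_surj) -[1](subrK P) (psiD psi_linear).
  by rewrite psiP psiQ addr0.
by move=> /boundedOp_eqP/(_ y)/eqP; apply/negP.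
Qed.
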